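(* For $i=1,2$ let $G_i$ be an $r_i$-uniform hypergraph, with $V(G_1)\cap V(G_2)=\emptyset$. If $p>r_1+r_2$, then \[ \lambda^{(p)}(G_1* G_2)=\frac{(r_1+r_2)^{1-(r_1+r_2)/p}}{r_1^{1-r_1/p}\,r_2^{1-r_2/p}}\,\lambda^{(p)}(G_1)\,\lambda^{(p)}(G_2). \]
   Context: A $k$-uniform hypergraph $G$ consists of a finite vertex set $V(G)$ and a set $E(G)$ of $k$-element subsets of $V(G)$ (edges). For $\bm{x}\in\mathbb{R}^{V(G)}$ let $P_G(\bm{x})=k\sum_{e\in E(G)}\prod_{v\in e}x_v$, and for real $p\ge1$ let $\|\bm{x}\|_p=(\sum_v|x_v|^p)^{1/p}$. The $p$-spectral radius of $G$ is $\lambda^{(p)}(G)=\max_{\|\bm{x}\|_p=1}P_G(\bm{x})$. For an $r_1$-uniform $G_1$ and an $r_2$-uniform $G_2$ with disjoint vertex sets, $G_1*G_2$ is the $(r_1+r_2)$-uniform hypergraph with $V(G_1*G_2)=V(G_1)\cup V(G_2)$ and $E(G_1*G_2)=\{e\cup f: e\in E(G_1), f\in E(G_2)\}$. *)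

(* Defs.v *)
From HB Require Import structures.
From mathcomp Require Import all_boot all_order all_algebra.
From mathcomp Require Import all_classical all_reals all_analysis.
Set Implicit Arguments.
Unset Strict Implicit.
Unset Printing Implicit Defensive.
Import Order.TTheory GRing.Theory Num.Theory.
Import numFieldNormedType.Exports.
Local Open Scope ring_scope.

(* Vertices are drawn from an ambient finite type [T], so that the disjointness
   of two vertex sets is an explicit hypothesis. *)
Record uhypergraph (T : finType) (k : nat) := UHypergraph {
  vertices : {set T};
  edges : {set {set T}};
  edges_sub : forall e, e \in edges -> e \subset vertices;
  edges_card : forall e, e \in edges -> #|e| = k
}.

Definition join_edges (T : finType) (r1 r2 : nat)
    (G1 : uhypergraph T r1) (G2 : uhypergraph T r2) : {set {set T}} :=
  [set e :|: f | e in edges G1, f in edges G2].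

Lemma join_edges_sub (T : finType) (r1 r2 : nat)
    (G1 : uhypergraph T r1) (G2 : uhypergraph T r2) e :
  e \in join_edges G1 G2 -> e \subset vertices G1 :|: vertices G2.
Proof.
case/imset2P=> e1 e2 e1G e2G ->.
by apply: finset.setUSS; [exact: edges_sub e1G | exact: edges_sub e2G].
Qed.

Lemma join_edges_card (T : finType) (r1 r2 : nat)
    (G1 : uhypergraph T r1) (G2 : uhypergraph T r2) e :
  [disjoint vertices G1 & vertices G2] ->
  e \in join_edges G1 G2 -> #|e| = (r1 + r2)%N.
Proof.
move=> dG /imset2P[e1 e2 e1G e2G ->].
rewrite finset.cardsU (edges_card e1G) (edges_card e2G).
have /disjoint_setI0 -> : [disjoint e1 & e2].
  apply: disjointWl (edges_sub e1G) _.
  by apply: disjointWr (edges_sub e2G) dG.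
by rewrite cards0 subn0.
Qed.

(* [G1 * G2]; disjointness is what makes it uniform. *)
Definition hjoin (T : finType) (r1 r2 : nat)
    (G1 : uhypergraph T r1) (G2 : uhypergraph T r2)
    (dG : [disjoint vertices G1 & vertices G2]) : uhypergraph T (r1 + r2) :=
  @UHypergraph T (r1 + r2) (vertices G1 :|: vertices G2) (join_edges G1 G2)
    (@join_edges_sub T r1 r2 G1 G2)
    (fun e => @join_edges_card T r1 r2 G1 G2 e dG).

(* Real vectors indexed by the vertex set of [G]. *)
Definition vvec (R : realType) (T : finType) (k : nat)
    (G : uhypergraph T k) : Type := {v : T | v \in vertices G} -> R.

(* By [edges_sub], the product for [e] runs over all of [e]. *)
Definition hpoly (R : realType) (T : finType) (k : nat)
    (G : uhypergraph T k) (x : vvec R G) : R :=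
  k%:R * \sum_(e in edges G)
           \prod_(v : {v : T | v \in vertices G} | val v \in e) x v.

Definition pnorm (R : realType) (T : finType) (k : nat)
    (G : uhypergraph T k) (p : R) (x : vvec R G) : R :=
  (\sum_(v : {v : T | v \in vertices G}) `|x v| `^ p) `^ p^-1.

(* The supremum is a maximum when [G] has a vertex (see [spectral_radiusP]);
   it is [0] when [G] has none, the unit sphere being then empty. *)
Definition spectral_radius (R : realType) (T : finType) (k : nat)
    (p : R) (G : uhypergraph T k) : R :=
  sup [set hpoly x | x in [set x : vvec R G | pnorm p x = 1]]%classic.

Section spectral_radius_max.
Local Open Scope classical_set_scope.
Context (R : realType) (T : finType) (k : nat) (G : uhypergraph T k).
Variable p : R.
Hypothesis p1 : 1 <= p.

Local Notation I := {v : T | v \in vertices G}.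
Local Notation X := (prod_topology (fun _ : I => R : topologicalType)).

Let p0 : 0 < p. Proof. exact: lt_le_trans p1. Qed.

Lemma continuous_normr_powR : continuous (fun x : R => `|x| `^ p).
Proof.
move=> x; have [->|x0] := eqVneq x 0; last first.
  apply: (@continuous_comp _ _ _ (fun x : R => `|x|) (fun y => y `^ p)).
    exact: norm_continuous.
  apply: differentiable_continuous; apply/derivable1_diffP.
  by apply: derivable_powR; rewrite in_itv/= andbT normr_gt0.
rewrite /continuous_at normr0 powR0 ?gt_eqF//.
apply: (@squeeze_cvgr _ _ _ _ (fun=> 0) (fun x : R => `|x|)).
- near=> y; rewrite powR_ge0 /=.
  have [->|y0] := eqVneq y 0; first by rewrite normr0 powR0 ?gt_eqF.
  apply: ge1r_powR => //; rewrite normr_gt0 y0/=.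
  near: y; apply: (@nbhs0_le _ R^o); exact: ltr01.
- exact: cvg_cst.
- by have := @norm_continuous _ R^o 0; rewrite /continuous_at normr0.
Unshelve. all: by end_near. Qed.

Lemma pnorm_eq1 (x : vvec R G) :
  pnorm p x = 1 <-> \sum_(v : I) `|x v| `^ p = 1.
Proof.
have s0 : 0 <= \sum_(v : I) `|x v| `^ p by apply: sumr_ge0 => v _; apply: powR_ge0.
split=> [/eqP|e]; last by rewrite /pnorm e powR1.
by rewrite powR_eq1 ltNge s0/= invr_eq0 (gt_eqF p0) orbF => /eqP.
Qed.

Let sphere : set X := [set x | pnorm p (x : vvec R G) = 1].

Let continuous_big_sum (Y : topologicalType) (J : Type) (r : seq J)
    (P : pred J) (f : J -> Y -> R) : (forall j, P j -> continuous (f j)) ->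
  continuous (fun x => \sum_(j <- r | P j) f j x).
Proof.
move=> cf; elim: r => [|j r IH] x.
  have -> : (fun x => \sum_(j <- [::] | P j) f j x) = cst 0.
    by apply/funext => y; rewrite big_nil.
  exact: cvg_cst.
have -> : (fun x => \sum_(j <- j :: r | P j) f j x) =
    (fun x => if P j then f j x + \sum_(j <- r | P j) f j x
               else \sum_(j <- r | P j) f j x).
  by apply/funext => y; rewrite big_cons.
have [Pj|_] := boolP (P j); last exact: IH.
by apply: (@cvgD _ R^o); [exact: cf | exact: IH].
Qed.

Let continuous_big_prod (Y : topologicalType) (J : Type) (r : seq J)
    (P : pred J) (f : J -> Y -> R) : (forall j, P j -> continuous (f j)) ->
  continuous (fun x => \prod_(j <- r | P j) f j x).
Proof.
move=> cf; elim: r => [|j r IH] x.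
  have -> : (fun x => \prod_(j <- [::] | P j) f j x) = cst 1.
    by apply/funext => y; rewrite big_nil.
  exact: cvg_cst.
have -> : (fun x => \prod_(j <- j :: r | P j) f j x) =
    (fun x => if P j then f j x * \prod_(j <- r | P j) f j x
               else \prod_(j <- r | P j) f j x).
  by apply/funext => y; rewrite big_cons.
have [Pj|_] := boolP (P j); last exact: IH.
by apply: (@cvgM R Y (nbhs x)); [exact: cf | exact: IH].
Qed.

Let continuous_hpoly : continuous (fun x : X => hpoly (x : vvec R G)).
Proof.
have proj v : continuous (fun x : X => x v).
  exact: (@proj_continuous I (fun=> R : topologicalType) v).
have cS : continuous (fun x : X => \sum_(e in edges G)
    \prod_(v : I | val v \in e) (x v : R)).
  apply: (@continuous_big_sum X) => e _.
  by apply: (@continuous_big_prod X) => v _; exact: proj.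
by move=> x; apply: (@cvgM R X (nbhs x) _ (cst k%:R)); [exact: cvg_cst | exact: cS].
Qed.

Let compact_sphere : compact sphere.
Proof.
pose s (x : X) : R := \sum_(v : I) `|x v| `^ p.
have sE : sphere = s @^-1` [set 1].
  by apply/seteqP; split=> x /=; [move/pnorm_eq1 | move=> ?; apply/pnorm_eq1].
have cs : continuous s.
  apply: (@continuous_big_sum X) => v _ x.
  apply: (@continuous_comp _ _ _ (fun x : X => x v) (fun y : R => `|y| `^ p)).
    exact: (@proj_continuous I (fun=> R : topologicalType) v).
  exact: continuous_normr_powR.
apply: (@subclosed_compact _ _ [set x : X | forall v, `[-1, 1]%classic (x v)]).
- rewrite sE; apply: (@preimage_closed X R s); last exact: (@closed_eq R).
  by move=> x _; exact: cs.
- apply: (@tychonoff I (fun=> R : topologicalType) (fun=> `[-1, 1]%classic)) => v.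
  exact: segment_compact.
- move=> x /pnorm_eq1 x1 v; rewrite /= in_itv/= -ler_norml.
  have : `|x v| `^ p <= 1.
    rewrite -x1 (bigD1 v)//= lerDl.
    by apply: sumr_ge0 => w _; apply: powR_ge0.
  by apply: contraTT; rewrite -!ltNge => x1';
    rewrite -[ltLHS](congr1 (@^~ p) (@powR1 R)) gt0_ltr_powR// nnegrE.
Qed.

Lemma spectral_radiusP : vertices G != finset.set0 ->
  exists2 x : vvec R G, pnorm p x = 1 /\ hpoly x = spectral_radius p G &
    forall y : vvec R G, pnorm p y = 1 -> hpoly y <= spectral_radius p G.
Proof.
case/set0Pn => v0 v0G.
have s0 : sphere !=set0.
  exists (fun v => (v == exist _ v0 v0G)%:R); apply/pnorm_eq1.
  rewrite (bigD1 (exist _ v0 v0G))//= eqxx normr1 powR1 big1 ?addr0// => v vv0.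
  by rewrite (negbTE vv0) normr0 powR0 ?gt_eqF.
have [|c] := compact_EVT_max s0 compact_sphere (f := fun x : X => hpoly (x : vvec R G)).
  exact: continuous_subspaceT continuous_hpoly.
rewrite inE => c1 cmax.
have ub : ubound [set hpoly x | x in [set x : vvec R G | pnorm p x = 1]] (hpoly (c : vvec R G)).
  by move=> _ [y y1 <-]; apply: cmax; rewrite inE.
have radE : hpoly (c : vvec R G) = spectral_radius p G.
  apply/eqP; rewrite eq_le; apply/andP; split.
    by apply: ub_le_sup; [exists (hpoly (c : vvec R G)) | exists c].
  by apply: ge_sup => //; exists (hpoly (c : vvec R G)), c.
exists c; first by split.
by move=> y y1; rewrite -radE; apply: ub; exists y.
Qed.

End spectral_radius_max.

(* Main.v *)
Require Import Defs.
From mathcomp Require Import all_boot all_order all_algebra.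
From mathcomp Require Import all_classical all_reals all_analysis.
From mathcomp Require Import ring.
Import Order.TTheory GRing.Theory Num.Theory.
Local Open Scope ring_scope.

(** The polynomial of the join factors as the product of the polynomials of
    [G1] and [G2] in disjoint sets of variables, and the [p]-th power of the
    norm is additive. If [x] has norm [1] and its parts on the two vertex sets
    carry the masses [a] and [b = 1 - a], homogeneity bounds the polynomial by
    a constant times [a `^ (r1 / p) * b `^ (r2 / p)], which weighted AM-GM
    maximizes at [a = r1 / (r1 + r2)]. Suitably scaled maximizers for [G1] and
    [G2] attain this bound. *)

(** Taking [f] on all of [T] lets one function be evaluated on [G1], on [G2] and on their join
    without transport between subtypes. *)
Definition edge_sum {R : realType} {T : finType} {k : nat}
    (G : uhypergraph T k) (f : T -> R) : R :=
  \sum_(e in edges G) \prod_(v in e) f v.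

Definition mass {R : realType} {T : finType} {k : nat}
    (p : R) (G : uhypergraph T k) (f : T -> R) : R :=
  \sum_(v in vertices G) `|f v| `^ p.

(** * Homogeneity and bounds for a single hypergraph *)

Section EdgeSum.
Context {R : realType} {T : finType} {k : nat} (G : uhypergraph T k).
Implicit Types (f g : T -> R) (p t : R).

Lemma hpoly_restr f :
  hpoly ((fun v => f (val v)) : vvec R G) = k%:R * edge_sum G f.
Proof.
congr (_ * _); apply: eq_bigr => e eG.
rewrite -(big_sub_cond (mem (vertices G)) (fun v => v \in e) f).
apply: eq_bigl => v /=; apply: andb_idl => ve.
exact: (fintype.subsetP (edges_sub eG)).
Qed.

Lemma mass_restr p f :
  \sum_(v : {v : T | v \in vertices G}) `|f (val v)| `^ p = mass p G f.
Proof. by rewrite -(big_sub (mem (vertices G)) (fun v => `|f v| `^ p)). Qed.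

Lemma vvec_restr (x : vvec R G) : exists f, x = (fun v => f (val v)).
Proof.
exists (fun v => if insub v is Some u then x u else 0).
by apply/funext => v; rewrite valK.
Qed.

Lemma eq_edge_sum f g :
  {in vertices G, f =1 g} -> edge_sum G f = edge_sum G g.
Proof.
move=> fg; apply: eq_bigr => e eG; apply: eq_bigr => v ve.
exact/fg/(fintype.subsetP (edges_sub eG)).
Qed.

Lemma eq_mass p f g : {in vertices G, f =1 g} -> mass p G f = mass p G g.
Proof. by move=> fg; apply: eq_bigr => v vG; rewrite fg. Qed.

Lemma edge_sumZ t f : edge_sum G (fun v => t * f v) = t ^+ k * edge_sum G f.
Proof.
rewrite /edge_sum mulr_sumr; apply: eq_bigr => e eG.
by rewrite big_split/= prodr_const (edges_card eG).
Qed.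

Lemma massZ p t f : 0 <= t -> mass p G (fun v => t * f v) = t `^ p * mass p G f.
Proof.
move=> t0; rewrite /mass mulr_sumr; apply: eq_bigr => v _.
by rewrite normrM ger0_norm// powRM.
Qed.

Lemma mass_normr p f : mass p G (fun v => `|f v|) = mass p G f.
Proof. by apply: eq_bigr => v _; rewrite normr_id. Qed.

Lemma mass_ge0 p f : 0 <= mass p G f.
Proof. by apply: sumr_ge0 => v _; exact: powR_ge0. Qed.

Lemma ler_norm_edge_sum f : `|edge_sum G f| <= edge_sum G (fun v => `|f v|).
Proof.
by apply: le_trans (ler_norm_sum _ _ _) _; apply: ler_sum => e _; rewrite normr_prod.
Qed.

(** Zero mass makes [f] vanish on the vertices, and [0 < k] gives each edge a vertex, hence a zero
    factor. *)
Lemma edge_sum_mass0 p f : (0 < k)%N -> mass p G f = 0 -> edge_sum G f = 0.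
Proof.
move=> k0 /eqP; rewrite psumr_eq0 => [/allP f0|v _]; last exact: powR_ge0.
apply: big1 => e eG.
have /card_gt0P[v ve] : (0 < #|e|)%N by rewrite (edges_card eG).
have vG := fintype.subsetP (edges_sub eG) _ ve.
have := f0 v (mem_index_enum _); rewrite vG/= powR_eq0 => /andP[/eqP/normr0_eq0 fv _].
by rewrite (bigD1 v)//= fv mul0r.
Qed.

(** Every norm is then 0, so the unit sphere is empty, and [sup] of the empty set is 0. *)
Lemma spectral_radius_no_vertex p :
  0 < p -> vertices G = finset.set0 -> spectral_radius p G = 0.
Proof.
move=> p0 G0; rewrite /spectral_radius (_ : [set x | _]%classic = classical_sets.set0).
  by rewrite image_set0 sup0.
apply/seteqP; split=> // x /=; have [f ->] := vvec_restr x.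
rewrite /pnorm mass_restr /mass G0 big_set0 powR0 ?invr_eq0 ?gt_eqF//.
by move/eqP; rewrite eq_sym oner_eq0.
Qed.

Lemma spectral_radius_attained p : 1 <= p -> vertices G != finset.set0 ->
  exists2 f, mass p G f = 1 & k%:R * edge_sum G f = spectral_radius p G.
Proof.
move=> p1 G0; have [x [x1 <-] _] := @spectral_radiusP R T k G p p1 G0.
have [f xf] := vvec_restr x; exists f; last by rewrite xf hpoly_restr.
by move: x1; rewrite pnorm_eq1// xf mass_restr.
Qed.

Lemma edge_sum_le_sphere p f : 1 <= p -> mass p G f = 1 ->
  k%:R * edge_sum G f <= spectral_radius p G.
Proof.
move=> p1 f1; have G0 : vertices G != finset.set0.
  apply: contra_eq_neq f1 => G0.
  by rewrite /mass G0 big_set0 eq_sym oner_neq0.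
have [_ _ ub] := @spectral_radiusP R T k G p p1 G0.
by rewrite -hpoly_restr; apply: ub; rewrite pnorm_eq1// mass_restr.
Qed.

(** Homogeneity carries the bound from the unit sphere to any [f]. The absolute value makes the left
    side nonnegative, so that two such bounds can be multiplied. *)
Lemma norm_edge_sum_le p f : (0 < k)%N -> 1 <= p ->
  k%:R * `|edge_sum G f| <= spectral_radius p G * mass p G f `^ (k%:R / p).
Proof.
move=> k0 p1; have p0 : 0 < p by exact: lt_le_trans p1.
have [m0|m0] := eqVneq (mass p G f) 0.
  rewrite (edge_sum_mass0 p f k0 m0) m0 normr0 mulr0 powR0 ?mulr0//.
  by rewrite mulf_neq0 ?invr_eq0 ?gt_eqF ?ltr0n.
have {}m0 : 0 < mass p G f by rewrite lt_def m0 mass_ge0.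
(* Scaling by [t] brings the mass of [|f|] to 1. *)
pose t := mass p G f `^ (- p^-1).
have t0 : 0 < t by exact: powR_gt0.
have : k%:R * edge_sum G (fun v => t * `|f v|) <= spectral_radius p G.
  apply: edge_sum_le_sphere => //.
  rewrite massZ ?ltW// mass_normr -powRrM mulNr mulVf ?gt_eqF//.
  by rewrite powR_inv1 ?mass_ge0// mulVf ?gt_eqF.
rewrite edge_sumZ.
have -> : t ^+ k = (mass p G f `^ (k%:R / p))^-1.
  by rewrite -powR_mulrn ?ltW// -powRrM -powRN mulNr [p^-1 * _]mulrC.
rewrite mulrCA mulrC ler_pdivrMr ?powR_gt0//; apply: le_trans.
by rewrite ler_wpM2l// ler_norm_edge_sum.
Qed.

Lemma spectral_radius_ge0 p : (0 < k)%N -> 1 <= p -> 0 <= spectral_radius p G.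
Proof.
move=> k0 p1; have [G0|G0] := eqVneq (vertices G) finset.set0.
  by rewrite spectral_radius_no_vertex// (lt_le_trans _ p1).
have [f f1 _] := spectral_radius_attained p p1 G0.
have := norm_edge_sum_le p f k0 p1; rewrite f1 powR1 mulr1.
by apply: le_trans; rewrite mulr_ge0.
Qed.

End EdgeSum.

(** * Mass and edge sum of a join *)

Section Join.
Context {R : realType} {T : finType} {r1 r2 : nat}.
Context {G1 : uhypergraph T r1} {G2 : uhypergraph T r2}.
Context (dG : [disjoint vertices G1 & vertices G2]).

Lemma mass_hjoin (p : R) f : mass p (hjoin dG) f = mass p G1 f + mass p G2 f.
Proof.
rewrite /mass -bigU//=.
by apply: eq_bigl => v; rewrite finset.in_setU.
Qed.

Lemma edge_sum_hjoin (f : T -> R) :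
  edge_sum (hjoin dG) f = edge_sum G1 f * edge_sum G2 f.
Proof.
rewrite /edge_sum big_distrlr pair_big_dep/= /join_edges curry_imset2X big_imset/=.
  apply: eq_big => [[e1 e2]|[e1 e2] /=]; first by rewrite finset.in_setX.
  rewrite finset.in_setX => /andP[e1G e2G].
  rewrite -bigU/=; first by apply: eq_bigl => v; rewrite finset.in_setU.
  apply: disjointWl (edges_sub e1G) _.
  exact: disjointWr (edges_sub e2G) dG.
(* Intersecting a joined edge with each vertex set recovers its two halves, so distinct pairs give
   distinct edges and no term is lost in the reindexing. *)
have trace e1 e2 : e1 \in edges G1 -> e2 \in edges G2 ->
    e1 = (e1 :|: e2) :&: vertices G1 /\ e2 = (e1 :|: e2) :&: vertices G2.
  move=> e1G e2G; rewrite !finset.setIUl.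
  rewrite (finset.setIidPl (edges_sub e1G)) (finset.setIidPl (edges_sub e2G)).
  rewrite (disjoint_setI0 (disjointWl (edges_sub e1G) dG)).
  have dG' : [disjoint vertices G2 & vertices G1] by rewrite disjoint_sym.
  rewrite (disjoint_setI0 (disjointWl (edges_sub e2G) dG')).
  by rewrite finset.setU0 finset.set0U.
move=> [e1 e2] [e1' e2']; rewrite !finset.in_setX => /andP[/= e1G e2G] /andP[/= e1G' e2G'] ee.
have [E1 E2] := trace _ _ e1G e2G; have [E1' E2'] := trace _ _ e1G' e2G'.
by congr pair; [rewrite E1 ee -E1' | rewrite E2 ee -E2'].
Qed.

End Join.

(** * Weighted AM-GM and the constant *)

Section Optimization.
Context {R : realType}.
Implicit Types (a b p x y : R).

Lemma powRV x y : 0 <= x -> x^-1 `^ y = (x `^ y)^-1.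
Proof. by move=> x0; rewrite -(powR_inv1 x0) -powRrM mulN1r powRN. Qed.

Lemma powR1B x y : 0 < x -> x `^ (1 - y) = x / x `^ y.
Proof. by move=> x0; rewrite powRB ?(gt_eqF x0) ?implybT// powRr1// ltW. Qed.

(** Young's inequality with exponents [x^-1] and [y^-1], applied to [(a / x)]^ x[and](b / y) [^ y],
    has right side [a + b = 1]. *)
Lemma weighted_amgm x y a b : 0 < x -> 0 < y -> 0 <= a -> 0 <= b ->
  x + y = 1 -> a + b = 1 -> a `^ x * b `^ y <= x `^ x * y `^ y.
Proof.
move=> x0 y0 a0 b0 xy ab.
have ax0 : 0 <= a / x by rewrite divr_ge0// ltW.
have by0 : 0 <= b / y by rewrite divr_ge0// ltW.
have := @conjugate_powR R ((a / x) `^ x) ((b / y) `^ y) x^-1 y^-1.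
rewrite !invrK !powR_ge0 !invr_gt0 => /(_ isT isT x0 y0 xy).
rewrite -!powRrM !divff ?gt_eqF// !powRr1// !divfK ?gt_eqF// ab.
have [x0' y0'] := (ltW x0, ltW y0).
rewrite !powRM ?invr_ge0// !(powRV _ _ x0', powRV _ _ y0').
by rewrite mulrACA -invfM ler_pdivrMr ?mul1r// mulr_gt0 ?powR_gt0.
Qed.

(** The exponents sum to [s = (m + n) / p], so AM-GM is used with weights [m / (m + n)],
    [n / (m + n)] and then raised to the power [s]. *)
Lemma weighted_amgm_nat (m n : nat) p a b : (0 < m)%N -> (0 < n)%N -> 0 < p ->
  0 <= a -> 0 <= b -> a + b = 1 ->
  a `^ (m%:R / p) * b `^ (n%:R / p) <=
  (m%:R / (m + n)%:R) `^ (m%:R / p) * (n%:R / (m + n)%:R) `^ (n%:R / p).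
Proof.
move=> m0 n0 p0 a0 b0 ab.
have mn0 : 0 < (m + n)%:R :> R by rewrite ltr0n addn_gt0 m0.
pose s := (m + n)%:R / p; have s0 : 0 < s by exact: divr_gt0.
have E (j : nat) : j%:R / p = j%:R / (m + n)%:R * s.
  by rewrite /s mulrA divfK// gt_eqF.
have x0 : 0 < m%:R / (m + n)%:R :> R by rewrite divr_gt0// ltr0n.
have y0 : 0 < n%:R / (m + n)%:R :> R by rewrite divr_gt0// ltr0n.
have xy : m%:R / (m + n)%:R + n%:R / (m + n)%:R = 1 :> R.
  by rewrite -mulrDl -natrD divff// gt_eqF.
rewrite (E m) (E n) !(powRrM _ _ s).
have := ge0_ler_powR (ltW s0) _ _ (weighted_amgm _ _ a b x0 y0 a0 b0 xy ab).
rewrite !nnegrE !mulr_ge0 ?powR_ge0// => /(_ isT isT).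
by rewrite (powRM s (powR_ge0 a _) (powR_ge0 b _))
  (powRM s (powR_ge0 (m%:R / _) _) (powR_ge0 (n%:R / _) _)).
Qed.

(** Splits the constant into the ratio of the uniformity factors in [hpoly] and the AM-GM
    maximum. *)
Lemma join_constE (m n : nat) p : (0 < m)%N -> (0 < n)%N ->
  (m + n)%:R `^ (1 - (m + n)%:R / p) /
    (m%:R `^ (1 - m%:R / p) * n%:R `^ (1 - n%:R / p)) =
  (m + n)%:R / (m%:R * n%:R) *
  ((m%:R / (m + n)%:R) `^ (m%:R / p) * (n%:R / (m + n)%:R) `^ (n%:R / p)).
Proof.
move=> m0 n0.
have M0 : 0 < m%:R :> R by rewrite ltr0n.
have N0 : 0 < n%:R :> R by rewrite ltr0n.
have S0 : 0 < (m + n)%:R :> R by rewrite ltr0n addn_gt0 m0.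
rewrite !powR1B// !powRM ?invr_ge0 ?ler0n//.
rewrite !(powRV (m + n)%:R) ?ler0n//.
have -> : (m + n)%:R `^ ((m + n)%:R / p) =
    (m + n)%:R `^ (m%:R / p) * (m + n)%:R `^ (n%:R / p) :> R.
  by rewrite -powRD ?(gt_eqF S0) ?implybT// -mulrDl natrD.
have pw (x y : R) : 0 < x -> x `^ y != 0 by move=> x0; rewrite gt_eqF ?powR_gt0.
field.
by rewrite !pw// !gt_eqF.
Qed.

End Optimization.

Theorem theorem3p11 (R : realType) (T : finType) (r1 r2 : nat)
    (hr1 : (0 < r1)%N) (hr2 : (0 < r2)%N)
    (G1 : uhypergraph T r1) (G2 : uhypergraph T r2)
    (dG : [disjoint vertices G1 & vertices G2])
    (p : R) (hp : (r1 + r2)%:R < p) :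
  spectral_radius p (hjoin dG) =
    (r1 + r2)%:R `^ (1 - (r1 + r2)%:R / p) /
      (r1%:R `^ (1 - r1%:R / p) * r2%:R `^ (1 - r2%:R / p)) *
      spectral_radius p G1 * spectral_radius p G2.
Proof.
have r0 : (0 < r1 + r2)%N by rewrite addn_gt0 hr1.
have p1 : 1 <= p by rewrite (le_trans _ (ltW hp))// ler1n.
have p0 : 0 < p by exact: lt_le_trans p1.
have R1 : 0 < r1%:R :> R by rewrite ltr0n.
have R2 : 0 < r2%:R :> R by rewrite ltr0n.
have R0 : 0 < (r1 + r2)%:R :> R by rewrite ltr0n.
rewrite join_constE//.
set K := (_ * _ as X in _ / _ * X).
have K0 : 0 <= K by rewrite mulr_ge0 ?powR_ge0.
have L1 := spectral_radius_ge0 G1 p hr1 p1.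
have L2 := spectral_radius_ge0 G2 p hr2 p1.
apply/eqP; rewrite eq_le; apply/andP; split.
  have [H0|H0] := eqVneq (vertices (hjoin dG)) finset.set0.
    rewrite (spectral_radius_no_vertex _ p p0 H0).
    by rewrite !mulr_ge0// invr_ge0 mulr_ge0.
  have [f f1 <-] := spectral_radius_attained _ p p1 H0.
  rewrite mass_hjoin in f1; rewrite edge_sum_hjoin.
  have AM : _ <= K :=
    weighted_amgm_nat r1 r2 p _ _ hr1 hr2 p0 (mass_ge0 _ _ _) (mass_ge0 _ _ _) f1.
  (* Upper bound: the two homogeneity bounds are multiplied, and [AM] absorbs the resulting powers
     of the masses into [K]. *)
  have B := ler_pM (mulr_ge0 (ltW R1) (normr_ge0 _)) (mulr_ge0 (ltW R2) (normr_ge0 _))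
    (norm_edge_sum_le G1 p f hr1 p1) (norm_edge_sum_le G2 p f hr2 p1).
  rewrite mulrACA -normrM [leRHS]mulrACA in B.
  have {}B := le_trans B (ler_wpM2l (mulr_ge0 L1 L2) AM).
  rewrite (_ : _ * _ * _ * _ = (r1 + r2)%:R *
    (spectral_radius p G1 * spectral_radius p G2 * K / (r1%:R * r2%:R))); last by ring.
  rewrite ler_wpM2l ?ler0n// ler_pdivlMr ?mulr_gt0// mulrC.
  by apply: le_trans B; rewrite ler_wpM2l ?mulr_ge0 ?ler0n ?ler_norm.
(* Lower bound: if a vertex set is empty, the right side is 0; otherwise both maximizers exist. *)
have [V1|V1] := eqVneq (vertices G1) finset.set0.
  by rewrite (spectral_radius_no_vertex G1)// mulr0 mul0r spectral_radius_ge0.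
have [V2|V2] := eqVneq (vertices G2) finset.set0.
  by rewrite (spectral_radius_no_vertex G2)// mulr0 spectral_radius_ge0.
have [f1 m1 <-] := spectral_radius_attained _ p p1 V1.
have [f2 m2 <-] := spectral_radius_attained _ p p1 V2.
have powRVK (x : R) : 0 <= x -> (x `^ p^-1) `^ p = x.
  by move=> x0; rewrite -powRrM mulVf ?gt_eqF// powRr1.
(* The scalings give the two parts of [f] the masses [r1 / (r1 + r2)] and [r2 / (r1 + r2)], where
   AM-GM is an equality. *)
pose s1 := (r1%:R / (r1 + r2)%:R) `^ p^-1 : R.
pose s2 := (r2%:R / (r1 + r2)%:R) `^ p^-1 : R.
pose f v := if v \in vertices G1 then s1 * f1 v else s2 * f2 v.
have fG1 : {in vertices G1, f =1 (fun v => s1 * f1 v)} by move=> v vG; rewrite /f vG.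
have fG2 : {in vertices G2, f =1 (fun v => s2 * f2 v)}.
  by move=> v vG; rewrite /f (disjointFl dG vG).
have : mass p (hjoin dG) f = 1.
  rewrite mass_hjoin (eq_mass _ _ _ _ fG1) (eq_mass _ _ _ _ fG2).
  rewrite (massZ _ _ s1) ?powR_ge0// (massZ _ _ s2) ?powR_ge0// m1 m2 !mulr1.
  rewrite /s1 /s2 !powRVK ?divr_ge0 ?ler0n//.
  by rewrite -mulrDl -natrD divff// gt_eqF.
move/(edge_sum_le_sphere _ p f p1); apply: le_trans.
rewrite edge_sum_hjoin (eq_edge_sum _ _ _ fG1) (eq_edge_sum _ _ _ fG2) !edge_sumZ.
(* [K] becomes [s1 ^+ r1 * s2 ^+ r2], the factor produced by homogeneity, so both sides agree. *)
rewrite /K ![_%:R / p]mulrC !powRrM -/s1 -/s2 !powR_mulrn ?powR_ge0//.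
rewrite le_eqVlt; apply/orP; left; apply/eqP; field.
by rewrite !gt_eqF.
Qed.
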